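(* Let $p\in\{2,4\}$, let $0<b<\frac{p}{2p-1}$ and $0\le n<1-\frac b2$, and for $t\ge 2$ set $$\Omega(t):=\{x\in\mathbb{R} : |x-t^n|<t^b \ \text{ or }\ |x+t^n|<t^b\}.$$ Suppose $u_0\in L^2(\mathbb{R})$ if $p=2$, and $u_0\in H^1(\mathbb{R})$ if $p=4$. Let $u=u(x,t)$ be the global solution of $$\partial_t u+\partial_x(\partial_x^2u+u^p)=0,\qquad (x,t)\in\mathbb{R}\times\mathbb{R},$$ with $u(0)=u_0$. Then $$\liminf_{t\to\infty}\int_{\Omega(t)}u^p(x,t)\,dx=0.$$
   Context: $u$ is real valued. The equation is the quadratic ($p=2$) or quartic ($p=4$) generalized Korteweg-de Vries equation. It is well known that it is globally well-posed in $L^2(\mathbb{R})$ for $p=2$ and in $H^1(\mathbb{R})$ for $p=4$; ''the solution'' is the one given by this theory. It belongs to $C(\mathbb{R}:L^2(\mathbb{R}))$, respectively $C(\mathbb{R}:H^1(\mathbb{R}))$, conserves the $L^2$ norm, and for $p=4$ has $H^1$ norm bounded uniformly in time. *)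

(* Defs.v *)
From mathcomp Require Import all_boot all_order all_algebra.
From mathcomp Require Import all_classical all_reals all_analysis.

Set Implicit Arguments.
Unset Strict Implicit.
Unset Printing Implicit Defensive.

Import Order.TTheory GRing.Theory Num.Theory.
Import numFieldNormedType.Exports.

Local Open Scope ring_scope.
Local Open Scope classical_set_scope.

Section FunctionSpaces.
Context {R : realType}.
Local Notation mu := (@lebesgue_measure R).

(* Elements of L^2 and H^1 are represented by functions; nothing below depends
   on the choice of representatives modulo equality almost everywhere. *)
Definition in_L2 (f : R -> R) : Prop := f \in Lfun mu 2%:E.

(* [fine] sends +oo to 0: only meaningful for [f] in L^2. *)
Definition L2norm (f : R -> R) : R := fine 'N[mu]_(2%:E)[EFin \o f].

Definition test_function (phi : R -> R) : Prop :=
  (forall k x, derivable (derive1n k phi) x 1) /\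
  compact (closure [set x | phi x != 0]).

Definition is_weak_derivative (f g : R -> R) : Prop :=
  forall phi, test_function phi ->
    \int[mu]_x (f x * derive1 phi x) = - \int[mu]_x (g x * phi x).

Definition L2_weak_derivatives (f : R -> R) : set (R -> R) :=
  [set g | in_L2 g /\ is_weak_derivative f g].

Definition in_H1 (f : R -> R) : Prop :=
  in_L2 f /\ L2_weak_derivatives f !=set0.

(* Weak derivatives are unique up to equality almost everywhere, so the choice
   does not affect [H1norm]; only meaningful for [f] in H^1. *)
Definition weak_derivative (f : R -> R) : R -> R :=
  xget (cst 0) (L2_weak_derivatives f).

Definition H1norm (f : R -> R) : R :=
  Num.sqrt (L2norm f ^+ 2 + L2norm (weak_derivative f) ^+ 2).

(* For space-time functions, [u t] is the spatial profile at time [t]. *)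
Definition continuous_in_L2 (u : R -> R -> R) : Prop :=
  (forall t, in_L2 (u t)) /\
  (forall t, L2norm (u s \- u t) @[s --> t] --> (0 : R)).

Definition continuous_in_H1 (u : R -> R -> R) : Prop :=
  (forall t, in_H1 (u t)) /\
  (forall t, H1norm (u s \- u t) @[s --> t] --> (0 : R)).

(* u_t + (u_xx + u^p)_x = 0 as an identity between distributions in x, for
   every time t; an odd number of derivatives falls on phi in both terms, whence
   the signs +. *)
Definition solves_gKdV (p : nat) (u : R -> R -> R) : Prop :=
  forall phi, test_function phi -> forall t : R,
    is_derive t 1 (fun s => \int[mu]_x (u s x * phi x))
      (\int[mu]_x (u t x * derive1n 3 phi x) + \int[mu]_x (u t x ^+ p * derive1 phi x)).

(* The global solution with datum [u0], characterised among distributional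
   solutions by the properties supplied by the well-posedness theory in L^2
   (p = 2) and in H^1 (p = 4). *)
Record gKdV_global_solution (p : nat) (u0 : R -> R) (u : R -> R -> R) : Prop := {
  gKdV_equation : solves_gKdV p u;
  gKdV_initial : ae_eq mu setT (u 0) u0;
  gKdV_mass : forall t, L2norm (u t) = L2norm u0;
  gKdV_L2 : p = 2%N -> continuous_in_L2 u;
  gKdV_H1 : p = 4%N ->
    continuous_in_H1 u /\ exists M : R, forall t, H1norm (u t) <= M
}.

Definition Omega (b n t : R) : set R :=
  [set x | `|x - t `^ n| < t `^ b \/ `|x + t `^ n| < t `^ b].

End FunctionSpaces.

(* Main.v *)
(* Suppose that the integral over Omega(t) is at least c0 > 0 for all large t.  Fix
   T large and b < q < min(4b, 2(1 - b), 2(1 - n)), which is possible since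
   b < 2/3 and n < 1 - b/2.  For tau = min(T, T^(b+1-n)) and t in [T, T + tau],
   Omega(t) stays within distance 3 T^b of T^n and -T^n.  Take the time-independent
   test function phi = sum over c = T^n, -T^n of H((x-c)/T^b) - H((x-c)/T^q), where
   H is a smooth step with H' >= 1 on [-3,3].  As u^p >= 0,
     d/dt <u, phi> >= c0 T^(-b) - C (T^(-q) + T^(-3b+q/2)) >= (c0/2) T^(-b),
   so <u, phi> grows by at least (c0/2) T^(-b) tau on [T, T + tau].  But
   |<u, phi>| = O(T^(q/2)) by Cauchy-Schwarz and conservation of the L^2 norm, and
   T^(-b) tau = T^(min(1-b, 1-n)) is much larger: a contradiction.

   The error T^(-q) requires a uniform bound on the integral of u^p; for p = 4 it
   comes from the embedding of H^1 into L^oo. *)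
Require Import Defs.
From mathcomp Require Import all_boot all_order all_algebra.
From mathcomp Require Import all_classical all_reals all_analysis.
From mathcomp Require Import measurable_realfun ring lra.
Import Order.TTheory GRing.Theory Num.Theory.
Import numFieldNormedType.Exports.
Set Implicit Arguments.
Unset Strict Implicit.
Unset Printing Implicit Defensive.
Local Open Scope ring_scope.
Local Open Scope classical_set_scope.

(** * A smooth step *)

Definition smooth (R : realType) (f : R -> R) : Prop :=
  forall k x, derivable (derive1n k f) x 1.

Lemma smooth_closed (R : realType) (C : set (R -> R)) :
  (forall f, C f -> (forall x, derivable f x 1) /\ C (derive1 f)) ->
  C `<=` @smooth R.
Proof.
move=> Cd f Cf k; have Ck : C (derive1n k f).
  by elim: k => [//|k IH]; rewrite derive1nS; have [] := Cd _ IH.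
by have [] := Cd _ Ck.
Qed.

(* [P.[1/x] exp(-1/x)], extended by [0] to [x <= 0]; the derivative of such a
   function has the same form, with [X^2 (P - P')] in place of [P]. *)
Definition flat_exp (R : realType) (P : {poly R}) (x : R) : R :=
  if 0 < x then P.[x^-1] * expR (- x^-1) else 0.

(** Induction on [P]: splitting off the constant coefficient moves one factor [y] into the power, so
    [k] has to stay general. Monomials are dominated by the power series of the exponential. *)
Lemma poly_expRN_bounded (R : realType) (P : {poly R}) (k : nat) :
  exists C : R, forall y, 0 <= y -> `|P.[y]| * y ^+ k * expR (- y) <= C.
Proof.
have mono j : exists C : R, forall y, 0 <= y -> y ^+ j * expR (- y) <= C.
  exists (j`!%:R + 1) => y y0; rewrite expRN ler_pdivrMr ?expR_gt0//.
  case: j => [|j].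
    rewrite expr0 fact0; have := expR_ge1Dx y; nra.
  have := expR_ge1Dxn j y0; rewrite -lerBrDl ler_pdivrMr ?ltr0n ?fact_gt0// => H.
  have f0 : (0 : R) < (j.+1)`!%:R by rewrite ltr0n fact_gt0.
  have := expR_ge1Dx y; nra.
elim/poly_ind: P k => [k|P c IH k].
  by exists 0 => y _; rewrite horner0 normr0 !mul0r.
have [C1 H1] := IH k.+1; have [C2 H2] := mono k.
exists (C1 + `|c| * C2) => y y0.
have e0 : 0 < expR (- y) by rewrite expR_gt0.
rewrite hornerMXaddC; apply: le_trans (lerD (H1 y y0)
  (ler_wpM2l (normr_ge0 c) (H2 y y0))).
rewrite mulrA -mulrDl ler_pM2r//.
rewrite exprS mulrA -mulrDl ler_wpM2r ?exprn_ge0//.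
by apply: le_trans (ler_normD _ _) _; rewrite normrM (ger0_norm y0).
Qed.

(** The preceding bound with [y = 1/x] and [k = 2]. Quadratic order at the origin makes the
    difference quotient there tend to [0]. *)
Lemma flat_exp_quadratic (R : realType) (P : {poly R}) :
  exists C : R, forall x, `|flat_exp P x| <= C * x ^+ 2.
Proof.
have [C HC] := poly_expRN_bounded P 2; exists C => x; rewrite /flat_exp.
have C0 : 0 <= C by apply: le_trans (HC 0 (lexx _)); rewrite expr0n mulr0 mul0r.
case: ifP => [x0|_]; last by rewrite normr0 mulr_ge0 ?sqr_ge0.
have xV : 0 <= x^-1 by rewrite invr_ge0 ltW.
have := HC _ xV.
rewrite normrM (ger0_norm (expR_ge0 _)) exprVn mulrAC ler_pdivrMr ?exprn_gt0//.
Qed.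

Lemma is_derive_flat_exp (R : realType) (P : {poly R}) (x : R) :
  is_derive x 1 (flat_exp P) (flat_exp ('X^2 * (P - P^`())) x).
Proof.
have [x0|x0|->] := ltgtP x 0.
- rewrite /flat_exp ltNge (ltW x0)/=.
  apply: (@near_eq_is_derive _ _ _ (cst 0)).
  near=> y => /=; rewrite ltNge ifF//; apply/negbTE; rewrite negbK; apply/ltW.
  by near: y; exact: lt_nbhsl.
- rewrite /flat_exp x0.
  have dV : is_derive x 1 (fun y : R => y^-1) (- x ^- 2).
    have := @is_deriveV _ id x 1 1; rewrite gt_eqF// => /(_ isT (is_derive_id _ _)).
    by move=> H; apply: is_derive_eq H _; rewrite /GRing.scale/= mulr1.
  have dP : is_derive x 1 (fun y : R => P.[y^-1]) (P^`().[x^-1] * - x ^- 2).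
    exact: (@is_derive1_comp _ (horner P) (fun y => y^-1)).
  have dE : is_derive x 1 (fun y : R => expR (- y^-1))
      (expR (- x^-1) * - - x ^- 2).
    exact: (@is_derive1_comp _ expR (fun y => - y^-1)).
  apply: (near_eq_is_derive _ (is_derive_eq (is_deriveM dP dE) _)).
    near=> y => /=; rewrite ifT//.
    by near: y; exact: lt_nbhsr.
  rewrite hornerM hornerXn hornerD hornerN -exprVn /GRing.scale/=; ring.
- have -> : flat_exp ('X^2 * (P - P^`())) 0 = 0 by rewrite /flat_exp ltxx.
  have [C HC] := flat_exp_quadratic P.
  have F0 : flat_exp P 0 = 0 by rewrite /flat_exp ltxx.
  suff H : (fun h => h^-1 *: (flat_exp P (h *: 1 + 0) - flat_exp P 0))
      @ 0^' --> (0 : R).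
    apply: DeriveDef; first by apply/cvg_ex; exists 0.
    exact/cvg_lim.
  have : (fun h : R => `|C| * `|h|) @ 0^' --> (`|C| * `|0 : R|).
    by apply: cvgM; [exact: cvg_cst | apply: cvg_norm; exact: nbhs_dnbhs].
  rewrite normr0 mulr0 => Hc.
  apply/norm_cvg0P; apply: squeeze_cvgr (cvg_cst 0) Hc; near=> h.
  rewrite normr_ge0/= F0 subr0 addr0 /GRing.scale/= mulr1 normrM.
  have h0 : h != 0 by near: h; exact: nbhs_dnbhs_neq.
  rewrite normfV mulrC ler_pdivrMr ?normr_gt0// -mulrA -expr2.
  apply: le_trans (HC h) _; rewrite real_normK ?num_real//.
  by rewrite ler_wpM2r ?sqr_ge0// ler_norm.
Unshelve. all: by end_near. Qed.

(** The derivative of each construction is again such a construction, so smoothness follows by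
    induction, without formulas for higher derivatives. Constants are affine maps with [a = 0]. *)
Inductive elementary (R : realType) : (R -> R) -> Prop :=
| elementary_flat P : elementary (flat_exp P)
| elementary_affine a b : elementary (fun x => a * x + b)
| elementaryD f g : elementary f -> elementary g ->
    elementary (fun x => f x + g x)
| elementaryM f g : elementary f -> elementary g ->
    elementary (fun x => f x * g x)
| elementary_comp f g : elementary f -> elementary g ->
    elementary (fun x => f (g x)).

Lemma elementary_derive (R : realType) (f : R -> R) : elementary f ->
  exists2 df : R -> R, elementary df & forall x : R, is_derive x 1 f (df x).
Proof.
elim=> {f}.
- by move=> P; exists (flat_exp ('X^2 * (P - P^`()))); [constructor|exact: is_derive_flat_exp].
- move=> a b; exists (fun x => 0 * x + a); first by constructor.
  move=> x; apply: is_derive_eq (is_deriveD (is_deriveM (is_derive_cst a x 1)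
    (is_derive_id x 1)) (is_derive_cst b x 1)) _.
  by rewrite /GRing.scale/=; ring.
- move=> f g _ [df ef Hf] _ [dg eg Hg].
  exists (fun x => df x + dg x); first by constructor.
  by move=> x; exact: is_deriveD.
- move=> f g ef [df edf Hf] eg [dg edg Hg].
  exists (fun x => f x * dg x + g x * df x).
    by apply: elementaryD; apply: elementaryM.
  by move=> x; exact: is_deriveM.
- move=> f g ef [df edf Hf] eg [dg edg Hg].
  exists (fun x => df (g x) * dg x).
    by apply: elementaryM => //; exact: elementary_comp.
  by move=> x; exact: is_derive1_comp.
Qed.

Lemma elementary_smooth (R : realType) : @elementary R `<=` @smooth R.
Proof.
apply: smooth_closed => f /elementary_derive[df edf Hf]; split=> [x|].
  by have [] := Hf x.
suff -> : derive1 f = df by [].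
by apply/funext => x; rewrite derive1E; have [_ ->] := Hf x.
Qed.

Lemma elementary_continuous (R : realType) (f : R -> R) :
  elementary f -> continuous f.
Proof.
move=> /elementary_derive[df _ Hf] x.
by apply: differentiable_continuous; apply/derivable1_diffP; have [] := Hf x.
Qed.

Lemma elementary_derive1n (R : realType) (f : R -> R) k :
  elementary f -> elementary (derive1n k f).
Proof.
move=> ef; elim: k => [//|k /elementary_derive[df edf Hf]].
rewrite derive1nS; suff -> : derive1 (derive1n k f) = df by [].
by apply/funext => x; rewrite derive1E; have [_ ->] := Hf x.
Qed.

(** The extreme value theorem covers [[-|a|, |a|]], the absolute value allowing for negative [a];
    the values on the constant tails are attained there. *)
Lemma elementary_bounded (R : realType) (f : R -> R) (a : R) :
  elementary f ->
  (forall x, x <= - a -> f x = f (- a)) -> (forall x, a <= x -> f x = f a) ->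
  exists2 B, 0 <= B & forall x, `|f x| <= B.
Proof.
move=> ef fl fr; have cf := elementary_continuous ef.
have cn : {within `[- `|a|, `|a|], continuous (fun x => `|f x|)}.
  by apply: continuous_subspaceT => x; apply: continuous_comp; [exact: cf|exact: norm_continuous].
have aa : - `|a| <= `|a| by rewrite (le_trans _ (normr_ge0 a))// oppr_le0.
have [z _ Hz] := EVT_max aa cn.
exists `|f z|; first by [].
have fE b : `|b| <= `|a| -> `|f b| <= `|f z|.
  by move=> ba; apply: Hz; rewrite in_itv/= -ler_norml.
move=> x; have [xa|ax] := lerP x (- a); first by rewrite fl// fE// normrN.
have [ax'|xa] := lerP a x; first by rewrite fr// fE.
apply: fE; rewrite [X in _ <= X]ger0_norm; last by lra.
by rewrite ler_norml !ltW.
Qed.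

Lemma is_derive_flat_exp1 (R : realType) (x : R) :
  is_derive x 1 (flat_exp 1) (flat_exp 'X^2 x).
Proof.
by apply: is_derive_eq (is_derive_flat_exp 1 x) _; rewrite derivC subr0 mulr1.
Qed.

Lemma flat_expXn_ge0 (R : realType) n (x : R) : 0 <= flat_exp 'X^n x.
Proof.
rewrite /flat_exp; case: ifP => // x0.
by rewrite hornerXn mulr_ge0 ?expR_ge0// exprn_ge0// invr_ge0 ltW.
Qed.

Lemma flat_expXn_gt0 (R : realType) n (x : R) : 0 < x -> 0 < flat_exp 'X^n x.
Proof.
by move=> x0; rewrite /flat_exp x0 hornerXn mulr_gt0 ?expR_gt0// exprn_gt0// invr_gt0.
Qed.

Lemma flat_exp1_incr (R : realType) (x y : R) :
  0 < y -> x < y -> flat_exp 1 x < flat_exp 1 y.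
Proof.
move=> y0 xy; rewrite /flat_exp y0; case: ifP => [x0|_]; last first.
  by rewrite hornerC mul1r expR_gt0.
by rewrite !hornerC !mul1r ltr_expR ltrN2 ltf_pV2 ?posrE.
Qed.

(** Normalised by its slope on [[-3, 3]], with [H 4] left free: after rescaling by [T^b] around
    [T^n] and [-T^n], the set [Omega] stays in this interval during the time span considered. *)
Definition step_function (R : realType) (H : R -> R) : Prop :=
  [/\ elementary H,
      forall x, x <= - 4 -> H x = 0,
      forall x, 4 <= x -> H x = H 4,
      forall x, 0 <= derive1 H x &
      forall x, - 3 <= x <= 3 -> 1 <= derive1 H x].

Lemma smooth_step (R : realType) : exists H : R -> R, step_function H.
Proof.
(* the outer [flat_exp] vanishes on negative numbers, so that [H0] is constant
   to the right of [4], where [w <= 0]; to the left of [-4], [w] is constant *)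
pose w (x : R) := flat_exp 1 (8 : R) - flat_exp 1 (x + 4).
pose H0 (x : R) := - flat_exp 1 (w x).
pose D (x : R) := flat_exp 'X^2 (w x) * flat_exp 'X^2 (x + 4).
have ew : elementary w.
  have -> : w = (fun x => (0 * x + flat_exp 1 8) +
      (0 * x + -1) * flat_exp 1 (1 * x + 4)).
    by apply/funext => x; rewrite /w mul1r; ring.
  apply: elementaryD; first by constructor.
  by apply: elementaryM; first constructor; apply: elementary_comp; constructor.
have eH0 : elementary H0.
  have -> : H0 = (fun x => (0 * x + -1) * flat_exp 1 (w x)).
    by apply/funext => x; rewrite /H0; ring.
  apply: elementaryM; first by constructor.
  by apply: (elementary_comp (f := flat_exp 1)) => //; constructor.
have eD : elementary D.
  apply: elementaryM.
    by apply: (elementary_comp (f := flat_exp 'X^2)) => //; constructor.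
  have -> : (fun x : R => flat_exp 'X^2 (x + 4)) =
      (fun x => flat_exp 'X^2 (1 * x + 4)).
    by apply/funext => x; rewrite mul1r.
  by apply: (elementary_comp (f := flat_exp 'X^2)); constructor.
have dH0 (x : R) : is_derive x 1 H0 (D x).
  have d4 : is_derive x 1 (fun y : R => y + 4) (1 : R).
    by apply: is_derive_eq (is_deriveD (is_derive_id x 1) (is_derive_cst (4 : R) x 1)) _;
      rewrite addr0.
  have dw : is_derive x 1 w (- flat_exp 'X^2 (x + 4)).
    have dF := @is_derive1_comp _ (flat_exp 1) (fun y => y + 4) x _ _
      (is_derive_flat_exp1 (x + 4)) d4.
    rewrite /w; apply: is_derive_eq (is_deriveB (is_derive_cst (flat_exp 1 8 : R) x 1) dF) _.
    by rewrite sub0r mulr1.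
  have dF := @is_derive1_comp _ (flat_exp 1) w x _ _ (is_derive_flat_exp1 (w x)) dw.
  apply: is_derive_eq (is_deriveN dF) _.
  by rewrite mulrN opprK.
have D0 x : 0 <= D x by rewrite mulr_ge0 ?flat_expXn_ge0.
have Dpos x : - 3 <= x <= 3 -> 0 < D x.
  move=> /andP[x3 x3']; rewrite mulr_gt0 ?flat_expXn_gt0//; last lra.
  by rewrite subr_gt0 flat_exp1_incr//; lra.
(* Dividing by the positive minimum [D z] makes the slope at least [1] on [[-3, 3]]; the additive
   constant in [H] below makes it vanish at [-4]. *)
have [z z3 Hz] : exists2 z, z \in `[(- 3 : R), 3]%R &
    forall x, x \in `[(- 3 : R), 3]%R -> D z <= D x.
  by apply: EVT_min; [lra | apply: continuous_subspaceT; exact: elementary_continuous].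
have Dz : 0 < D z by apply: Dpos; move: z3; rewrite in_itv.
pose H x := (D z)^-1 * H0 x + (- (D z)^-1 * H0 (- 4)).
have HE (x : R) : derive1 H x = (D z)^-1 * D x.
  rewrite derive1E.
  have [_ ->] := is_deriveD (is_deriveM (is_derive_cst (D z)^-1 x 1) (dH0 x))
     (is_derive_cst (- (D z)^-1 * H0 (- 4)) x 1).
  by rewrite /GRing.scale/= mulr0 !addr0.
exists H; split.
- exact: (elementary_comp (f := fun x => (D z)^-1 * x + (- (D z)^-1 * H0 (- 4)))
     (elementary_affine _ _) eH0).
- move=> x x4; rewrite /H.
  suff -> : H0 x = H0 (- 4) by ring.
  rewrite /H0 /w; congr (- flat_exp 1 (_ - _)); rewrite /flat_exp.
  by rewrite !ifF//; apply/negbTE; rewrite -leNgt; lra.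
- have HR x : 4 <= x -> H0 x = 0.
    move=> x4; rewrite /H0 [flat_exp 1 (w x)]/flat_exp ifF ?oppr0//.
    apply/negbTE; rewrite -leNgt subr_le0.
    have [->|x4'] := eqVneq x 4; first by rewrite -natrD.
    apply/ltW/flat_exp1_incr; first lra.
    have : 4 < x by rewrite lt_neqAle eq_sym x4' x4.
    lra.
  by move=> x x4; rewrite /H (HR _ x4) (HR _ (lexx 4)).
- by move=> x; rewrite HE mulr_ge0// invr_ge0 ltW.
- move=> x x3; rewrite HE mulrC ler_pdivlMr// mul1r; apply: Hz.
  by rewrite in_itv.
Qed.

(** * Derivatives of rescaled steps and of their differences *)

Lemma derive1_locally_cst (R : realType) (f : R -> R) (U : set R) (c : R) :
  open U -> (forall x, U x -> f x = c) -> forall x, U x -> derive1 f x = 0.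
Proof.
move=> oU Uf x Ux; rewrite derive1E.
have fc : \near x, cst c x = f x.
  by near=> y; rewrite Uf//; near: y; exact: open_nbhs_nbhs.
by have [_ ->] := near_eq_is_derive fc (is_derive_cst c x 1).
Unshelve. all: by end_near. Qed.

Lemma elementary_affine_comp (R : realType) (f : R -> R) (c r : R) :
  elementary f -> elementary (fun x => f ((x - c) / r)).
Proof.
move=> ef; have -> : (fun x => f ((x - c) / r)) = (fun x => f (r^-1 * x + - c / r)).
  by apply/funext => x; congr f; ring.
by apply: (elementary_comp ef); constructor.
Qed.

Lemma elementaryB (R : realType) (f g : R -> R) :
  elementary f -> elementary g -> elementary (fun x => f x - g x).
Proof.
move=> ef eg; have -> : (fun x => f x - g x) = (fun x => f x + (0 * x + -1) * g x).
  by apply/funext => x; ring.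
by apply: (elementaryD ef); apply: elementaryM => //; constructor.
Qed.

Lemma elementary_is_derive (R : realType) (f : R -> R) (x : R) :
  elementary f -> is_derive x 1 f (derive1 f x).
Proof. by move=> /elementary_derive[df _ /(_ x)[? _]]; rewrite derive1E. Qed.

Lemma derive1n_affine_comp (R : realType) (f : R -> R) (c r : R) k :
  elementary f ->
  derive1n k (fun x => f ((x - c) / r)) =
  (fun x => derive1n k f ((x - c) / r) / r ^+ k).
Proof.
move=> ef; elim: k => [|k IH].
  by apply/funext => x /=; rewrite expr0 divr1.
rewrite !derive1nS {}IH; apply/funext => x; rewrite derive1E.
have da : is_derive x 1 (fun y : R => (y - c) / r) r^-1.
  apply: is_derive_eq (is_deriveM (is_deriveB (is_derive_id x 1)
    (is_derive_cst c x 1)) (is_derive_cst r^-1 x 1)) _.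
  by rewrite /GRing.scale/=; ring.
have df := @is_derive1_comp _ (derive1n k f) (fun y => (y - c) / r) x _ _
  (elementary_is_derive _ (elementary_derive1n k ef)) da.
have [_ ->] := is_deriveM df (is_derive_cst (r ^+ k)^-1 x 1).
by rewrite /GRing.scale/= mulr0 add0r exprS invfM mulrC mulrA.
Qed.

Lemma derive1nB_elementary (R : realType) (f g : R -> R) k :
  elementary f -> elementary g ->
  derive1n k (fun x => f x - g x) = (fun x => derive1n k f x - derive1n k g x).
Proof.
move=> ef eg; elim: k => [//|k IH].
rewrite !derive1nS {}IH; apply/funext => x; rewrite derive1E.
by have [_ ->] := is_deriveB (elementary_is_derive x (elementary_derive1n k ef))
  (elementary_is_derive x (elementary_derive1n k eg)).
Qed.

(** [H] is constant on both tails. The strict inequality describes open half-lines, on which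
    induction on [k] can differentiate a constant. *)
Lemma step_derive1n_eq0 (R : realType) (H : R -> R) k (x : R) :
  step_function H -> 4 < `|x| -> derive1n k.+1 H x = 0.
Proof.
move=> [eH Hl Hr _ _]; rewrite lter_normr => /orP[x4|x4]; [|have {}x4 : x < - 4 by lra].
  elim: k x x4 => [|k IH]; rewrite derive1nS => x x4.
    apply: (@derive1_locally_cst _ _ `]4, +oo[%classic (H 4)) => //=.
      by move=> y; rewrite in_itv/= andbT => /ltW /Hr.
    by rewrite in_itv/= andbT.
  apply: (@derive1_locally_cst _ _ `]4, +oo[%classic 0) => //=.
    by move=> y; rewrite in_itv/= andbT => /IH.
  by rewrite in_itv/= andbT.
elim: k x x4 => [|k IH]; rewrite derive1nS => x x4.
  apply: (@derive1_locally_cst _ _ `]-oo, - 4[%classic 0) => //=.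
  by move=> y; rewrite in_itv/= => /ltW /Hl.
apply: (@derive1_locally_cst _ _ `]-oo, - 4[%classic 0).
- exact: interval_open.
- by move=> y /=; rewrite in_itv/= => /IH.
- by rewrite /= in_itv.
Qed.

Lemma step_derive1n_bounded (R : realType) (H : R -> R) k :
  step_function H -> exists2 B, 0 <= B & forall x, `|derive1n k H x| <= B.
Proof.
move=> sH; have [eH Hl Hr _ _] := sH.
(* The threshold is [5] because the derivatives are known to vanish only strictly beyond [4]. *)
apply: (@elementary_bounded _ _ 5); first exact: elementary_derive1n.
  case: k => [|k] x x5; first by rewrite derive1n0 !Hl//; lra.
  by rewrite !step_derive1n_eq0// lter_normr; apply/orP; right; lra.
case: k => [|k] x x5; first by rewrite derive1n0 Hr ?[H 5]Hr//; lra.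
by rewrite !step_derive1n_eq0// lter_normr; apply/orP; left; lra.
Qed.

(* The derivative is a positive bump of height [1/r] and width [r], minus a much
   flatter one of height [1/s] and width [s], which makes the support compact. *)
Definition bump (R : realType) (H : R -> R) (c r s x : R) : R :=
  H ((x - c) / r) - H ((x - c) / s).

Section bump.
Context (R : realType) (H : R -> R) (c r s : R).
Hypotheses (sH : step_function H) (r0 : 0 < r) (rs : r <= s).

Let s0 : 0 < s. Proof. exact: lt_le_trans rs. Qed.
Let eH : elementary H. Proof. by case: sH. Qed.

Let rs4 : 4 * r <= 4 * s. Proof. by rewrite ler_pM2l. Qed.

Lemma bump_elementary : elementary (bump H c r s).
Proof. by apply: elementaryB; exact: elementary_affine_comp. Qed.

Lemma derive1n_bump k x : derive1n k (bump H c r s) x =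
  derive1n k H ((x - c) / r) / r ^+ k - derive1n k H ((x - c) / s) / s ^+ k.
Proof.
by rewrite derive1nB_elementary ?derive1n_affine_comp//; exact: elementary_affine_comp.
Qed.

(** Since [r <= s], both steps have reached the same plateau, [0] on the left or [H 4] on the right,
    and cancel. *)
Lemma bump_eq0 x : 4 * s < `|x - c| -> bump H c r s x = 0.
Proof.
have [_ Hl Hr _ _] := sH; rewrite /bump lter_normr => /orP[|] xs.
  have xs4 : 4 <= (x - c) / s by rewrite ler_pdivlMr//; lra.
  have xr4 : 4 <= (x - c) / r by rewrite ler_pdivlMr// (le_trans rs4)// ltW.
  by rewrite Hr// [H (_ / s)]Hr// subrr.
have xs4 : (x - c) / s <= - 4 by rewrite ler_pdivrMr//; lra.
have xr4 : (x - c) / r <= - 4.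
  by rewrite ler_pdivrMr// mulNr lerNr (le_trans rs4)// ltW.
by rewrite Hl// [H (_ / s)]Hl// subrr.
Qed.

Lemma derive1n_bump_eq0 k x : 4 * s < `|x - c| ->
  derive1n k (bump H c r s) x = 0.
Proof.
case: k => [|k]; first exact: bump_eq0.
move=> xs; have E t : 0 < t -> t <= s -> 4 < `|(x - c) / t|.
  by move=> t0 ts; rewrite normrM normfV (gtr0_norm t0) ltr_pdivlMr//
    (le_lt_trans _ xs)// ler_pM2l.
by rewrite derive1n_bump !step_derive1n_eq0 ?E// !mul0r subrr.
Qed.

Lemma bump_test_function : test_function (bump H c r s).
Proof.
split; first by move=> k x; exact: (elementary_smooth bump_elementary).
apply: (@subclosed_compact _ _ `[c - 4 * s, c + 4 * s]%classic).
- exact: closed_closure.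
- exact: segment_compact.
- rewrite closureE => x /(_ `[c - 4 * s, c + 4 * s]%classic); apply; split.
    exact: interval_closed.
  move=> y /=; apply: contraNT; rewrite in_itv/= -ler_distlC => ys.
  apply/eqP; apply: bump_eq0; move: ys; rewrite -ltNge distrC//.
Qed.

End bump.

(** * Pairings in L^2 *)

Section L2.
Context (R : realType).
Local Notation mu := (@lebesgue_measure R).
Implicit Types f g : R -> R.

Lemma in_L2_measurable f : in_L2 f -> measurable_fun setT f.
Proof. by rewrite /in_L2 inE => /andP[/[!inE]]. Qed.

Lemma in_L2_fin_num f : in_L2 f -> ('N[mu]_(2%:E)[EFin \o f])%E \is a fin_num.
Proof.
rewrite /in_L2 inE => /andP[_ /[!inE]] H.
by rewrite ge0_fin_numE ?Lnorm_ge0.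
Qed.

Lemma L2norm_ge0 f : 0 <= L2norm f.
Proof. by rewrite fine_ge0// Lnorm_ge0. Qed.

Lemma Lnorm2_sqr f :
  (('N[mu]_(2%:E)[EFin \o f]) `^ 2 = \int[mu]_x (f x ^+ 2)%:E)%E.
Proof.
rewrite powR_Lnorm//; apply: eq_integral => x _ /=.
by rewrite powR_mulrn// real_normK// num_real.
Qed.

Lemma L2norm_sqr f : in_L2 f -> L2norm f ^+ 2 = \int[mu]_x (f x ^+ 2).
Proof.
move=> f2; rewrite /Rintegral -Lnorm2_sqr -(fineK (in_L2_fin_num f2)).
by rewrite poweR_EFin/= powR_mulrn// L2norm_ge0.
Qed.

Lemma in_L2I f : measurable_fun setT f ->
  mu.-integrable setT (EFin \o (fun x => f x ^+ 2)) -> in_L2 f.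
Proof.
move=> mf /integrableP[_ if2]; rewrite /in_L2 inE; apply/andP; split.
  by rewrite inE.
rewrite inE /= /finite_norm (@lty_poweRy _ _ 2)// Lnorm2_sqr.
apply: le_lt_trans if2; apply: ge0_le_integral => //.
- by move=> x _; rewrite lee_fin sqr_ge0.
- by apply/measurable_EFinP; exact: measurable_funX.
- by apply: measurableT_comp => //; apply/measurable_EFinP; exact: measurable_funX.
- by move=> x _ /=; rewrite lee_fin ler_norm.
Qed.

Lemma cauchy_schwarz f g : in_L2 f -> in_L2 g ->
  mu.-integrable setT (EFin \o (fun x => f x * g x)) /\
  `|\int[mu]_x (f x * g x)| <= L2norm f * L2norm g.
Proof.
move=> f2 g2; have ifg : mu.-integrable setT (EFin \o (fun x => f x * g x)).
  exact/Lfun1_integrable/Lfun2_mul_Lfun1.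
split=> //; rewrite -lee_fin EFinM.
rewrite (fineK (in_L2_fin_num f2)) (fineK (in_L2_fin_num g2)).
rewrite EFin_normr_Rintegral//.
have mf := in_L2_measurable f2; have mg := in_L2_measurable g2.
apply: le_trans (@hoelder _ _ _ mu f g 2 2 mf mg _ _ _) => //; last by lra.
rewrite Lnorm1; apply: le_abse_integral => //.
by case/integrableP: ifg.
Qed.

Lemma integrable_scale f (a : R) : mu.-integrable setT (EFin \o f) ->
  mu.-integrable setT (EFin \o (fun x => a * f x)).
Proof.
move=> fi.
have -> : EFin \o (fun x => a * f x) = (fun x => a%:E * (EFin \o f) x)%E by [].
exact: integrableZl.
Qed.

Lemma integrable_bounded_mul f g (B : R) : measurable_fun setT g ->
  (forall x, `|g x| <= B) -> mu.-integrable setT (EFin \o f) ->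
  mu.-integrable setT (EFin \o (fun x => f x * g x)).
Proof.
move=> mg gB fi; have mf : measurable_fun setT f.
  by apply/measurable_EFinP; case/integrableP: fi.
apply: (@le_integrable _ _ _ mu setT _ _ (EFin \o (fun x => B * f x))) => //.
- by apply/measurable_EFinP; exact: measurable_funM.
- move=> x _ /=; rewrite lee_fin !normrM mulrC ler_wpM2r//.
  by apply: le_trans (gB x) _; rewrite ler_norm.
- exact: integrable_scale.
Qed.

(** The square of [g] is at most [B^2] times the indicator of an interval of length [2 * d]. *)
Lemma bounded_support_L2 g (c d B : R) : measurable_fun setT g ->
  0 <= d -> 0 <= B -> (forall x, `|g x| <= B) ->
  (forall x, d < `|x - c| -> g x = 0) ->
  in_L2 g /\ L2norm g <= B * Num.sqrt (2 * d).
Proof.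
move=> mg d0 B0 gB g0; pose I := `[c - d, c + d]%classic : set R.
have mI : measurable I by exact: measurable_itv.
have muI : mu I = (2 * d)%:E.
  rewrite lebesgue_measure_itv/= lte_fin; case: ltP => cd.
    by rewrite -EFinD; congr (_%:E); ring.
  by congr (_%:E); lra.
have iI : mu.-integrable setT (EFin \o (\1_I : R -> R)).
  apply/integrableP; split; first by apply/measurable_EFinP; exact: measurable_indic.
  under eq_integral => x _ do rewrite /= ger0_norm//.
  by rewrite integral_indic// setIT -[X in (X < _)%E]/(mu I) muI ltry.
have iBI : mu.-integrable setT (EFin \o (fun x => B ^+ 2 * \1_I x)).
  exact: integrable_scale.
have gI x : g x ^+ 2 <= B ^+ 2 * \1_I x.
  have [xd|xd] := ltP d `|x - c|.
    by rewrite g0// expr0n mulr_ge0// sqr_ge0.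
  rewrite indicE mem_set ?mulr1; last by rewrite /I/= in_itv/= -ler_distlC distrC.
  by rewrite -(real_normK (num_real _)) lerXn2r// nnegrE.
have ig : mu.-integrable setT (EFin \o (fun x => g x ^+ 2)).
  apply: le_integrable iBI => //; first by apply/measurable_EFinP; exact: measurable_funX.
  by move=> x _ /=; rewrite lee_fin ger0_norm ?sqr_ge0// (le_trans (gI x))// ler_norm.
have g2 := in_L2I mg ig; split=> //.
rewrite -(@ler_pXn2r _ 2)// ?nnegrE ?L2norm_ge0 ?mulr_ge0 ?sqrtr_ge0//.
rewrite L2norm_sqr// exprMn sqr_sqrtr ?mulr_ge0//.
apply: le_trans (le_Rintegral _ ig iBI _) _ => //.
by rewrite RintegralZl// /Rintegral integral_indic// setIT -[X in fine X]/(mu I) muI.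
Qed.

Lemma L2_pairing_bound f g (c d B : R) : in_L2 f -> measurable_fun setT g ->
  0 <= d -> 0 <= B -> (forall x, `|g x| <= B) ->
  (forall x, d < `|x - c| -> g x = 0) ->
  mu.-integrable setT (EFin \o (fun x => f x * g x)) /\
  `|\int[mu]_x (f x * g x)| <= L2norm f * (B * Num.sqrt (2 * d)).
Proof.
move=> f2 mg d0 B0 gB g0.
have [g2 gle] := bounded_support_L2 mg d0 B0 gB g0.
have [ifg fg] := cauchy_schwarz f2 g2; split=> //.
by apply: le_trans fg _; rewrite ler_wpM2l// L2norm_ge0.
Qed.

End L2.

Lemma elementary_measurable (R : realType) (f : R -> R) :
  elementary f -> measurable_fun setT f.
Proof. by move=> /elementary_continuous; exact: continuous_measurable_fun. Qed.

(** * Boundedness of H^1 functions *)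

Section H1_bounded.
Context (R : realType).
Local Notation mu := (@lebesgue_measure R).
Implicit Types f g : R -> R.

Lemma in_L2_indic_ball (c d : R) : 0 <= d -> in_L2 (\1_(ball c d) : R -> R).
Proof.
move=> d0; apply: (proj1 (@bounded_support_L2 _ _ c d 1 _ d0 ler01 _ _)).
- by apply: measurable_indic; exact: measurable_ball.
- by move=> x; rewrite indicE; case: (_ \in _); rewrite ?normr1 ?normr0.
- move=> x dx; rewrite indicE memNset// /ball/= => h.
  by move: dx; rewrite distrC ltNge ltW.
Qed.

(** This is the hypothesis of Lebesgue differentiation. A compact set lies in a ball, whose
    indicator is in L^2, so Cauchy-Schwarz applies. *)
Lemma L2_locally_integrable f : in_L2 f -> locally_integrable setT f.
Proof.
move=> f2; split; [exact: in_L2_measurable|exact: openT|move=> K _ cK].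
have mf := in_L2_measurable f2.
have [M [_ HM]] := compact_bounded cK.
(* [HM] needs a bound strictly above [M], for which [|M| + 1] serves; the ball is open, which costs
   another unit. *)
pose d := `|M| + 2.
have d0 : 0 <= d by rewrite addr_ge0.
have [/integrableP[mfi ifoo] _] := cauchy_schwarz f2 (in_L2_indic_ball 0 d0).
apply: le_lt_trans ifoo.
have mK : measurable K by exact: compact_measurable.
have -> : (\int[mu]_(x in K) `|f x|%:E =
    \int[mu]_(x in K) `|(f x * \1_(ball 0 d) x)%:E|)%E.
  apply: eq_integral => x /set_mem xK; rewrite indicE mem_set ?mulr1//.
  rewrite /ball/= sub0r normrN; apply: le_lt_trans (HM (`|M| + 1) _ x xK) _.
    by rewrite (le_lt_trans (ler_norm _))// ltrDl.
  by rewrite /d ltrD2l ltr1n.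
by apply: ge0_subset_integral => //; exact: measurableT_comp.
Qed.

Lemma elementary_FTC (H : R -> R) (a b : R) : elementary H -> a < b ->
  (\int[mu]_(x in `[a, b]) (derive1 H x)%:E = (H b)%:E - (H a)%:E)%E.
Proof.
move=> eH ab; have cH := elementary_continuous eH.
apply: continuous_FTC2 => //.
  by apply: continuous_subspaceT; exact: elementary_continuous (elementary_derive1n 1 eH).
split.
- by move=> x _; have [] := elementary_is_derive x eH.
- by apply: cvg_at_right_filter; exact: cH.
- by apply: cvg_at_left_filter; exact: cH.
Qed.

Lemma elementary_MVT (H : R -> R) (a b : R) : elementary H -> a < b ->
  exists2 c, a < c < b & H b - H a = derive1 H c * (b - a).
Proof.
move=> eH ab; have [||c] := @MVT _ H (derive1 H) a b ab.
- by move=> x _; exact: elementary_is_derive.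
- by apply: continuous_subspaceT; exact: elementary_continuous.
- by rewrite in_itv/= => cab HE; exists c.
Qed.

(** [H] rises by at least [6] over [[-3, 3]] and does not decrease on [[-4, -3]] and [[3, 4]].
    Positivity allows division by this total mass. *)
Lemma step_total_gt0 (H : R -> R) : step_function H -> 0 < H 4.
Proof.
move=> [eH Hl _ H0 H1].
have [c1 _ E1] := elementary_MVT eH (ltr_nat R 3 4 : (3 < 4 :> R)).
have [c2 c23 E2] : exists2 c, - 3 < c < 3 & H 3 - H (- 3) = derive1 H c * (3 - - 3).
  by apply: elementary_MVT => //; lra.
have [c3 _ E3] : exists2 c, - 4 < c < - 3 & H (- 3) - H (- 4) = derive1 H c * (- 3 - - 4).
  by apply: elementary_MVT => //; lra.
have := H0 c1; have := H0 c3; have := Hl (- 4) (lexx _).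
have : 1 <= derive1 H c2 by apply: H1; case/andP: c23 => ? ?; lra.
lra.
Qed.

(** The narrow part of the derivative of a bump: as [r] tends to [0], an approximate identity at
    [c], of total mass [H 4] instead of [1]. *)
Definition rescaled_step (H : R -> R) (c r x : R) : R := derive1 H ((x - c) / r) / r.

Section rescaled.
Variables (H : R -> R) (B c r : R).
Hypotheses (sH : step_function H) (HB : forall x, `|derive1 H x| <= B) (r0 : 0 < r).

Let eH : elementary H. Proof. by case: sH. Qed.

Lemma rescaled_step_derive :
  rescaled_step H c r = derive1 (fun x => H ((x - c) / r)).
Proof.
by rewrite -derive1n1 derive1n_affine_comp.
Qed.

Lemma rescaled_step_measurable : measurable_fun setT (rescaled_step H c r).
Proof.
rewrite rescaled_step_derive -derive1n1.
exact: elementary_measurable (elementary_derive1n 1 (elementary_affine_comp c r eH)).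
Qed.

Lemma rescaled_step_bounded x : `|rescaled_step H c r x| <= B / r.
Proof. by rewrite normrM normfV (gtr0_norm r0) ler_pM2r ?invr_gt0. Qed.

Lemma rescaled_step_eq0 x : 4 * r < `|x - c| -> rescaled_step H c r x = 0.
Proof.
move=> xr; rewrite /rescaled_step -derive1n1 (step_derive1n_eq0 _ sH) ?mul0r//.
by rewrite normrM normfV (gtr0_norm r0) ltr_pdivlMr.
Qed.

Lemma integral_rescaled_step : \int[mu]_x rescaled_step H c r x = H 4.
Proof.
rewrite (_ : rescaled_step H c r =
  rescaled_step H c r \_ `[c - 5 * r, c + 5 * r]%classic).
  rewrite -Rintegral_mkcond /Rintegral rescaled_step_derive elementary_FTC//=.
  - have [_ Hl Hr _ _] := sH.
    have -> : (c + 5 * r - c) / r = 5 by field; rewrite gt_eqF.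
    have -> : (c - 5 * r - c) / r = - 5 by field; rewrite gt_eqF.
    have -> : H 5 = H 4 by apply: Hr; rewrite ler_nat.
    have -> : H (- 5) = 0 by apply: Hl; rewrite lerN2 ler_nat.
    by rewrite subr0.
  - exact: elementary_affine_comp.
  - have := r0; lra.
apply/funext => x; rewrite patchE; case: ifPn => // /negP xI.
apply: rescaled_step_eq0; rewrite ltNge; apply/negP => xr; apply: xI.
rewrite inE/= in_itv/= -ler_distlC distrC (le_trans xr)//.
by rewrite ler_wpM2r ?ltW// ltr_nat.
Qed.

(** As the kernel has mass [H 4], the difference is the integral of [f - f c] against it. The kernel
    is at most [B / r] and lives in a ball of measure [10 * r], whence the factor [B * 10]. *)
Lemma rescaled_step_average f : in_L2 f ->
  (`|\int[mu]_x (f x * rescaled_step H c r x) - f c * H 4|%:E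
   <= (B * 10)%:E * davg f c (5 * r))%E.
Proof.
move=> f2; have r5 : 0 <= 5 * r by rewrite mulr_ge0// ltW.
pose h := rescaled_step H c r; pose b := ball c (5 * r) : set R.
have B0 : 0 <= B by apply: le_trans (HB 0).
have mh : measurable_fun setT h := rescaled_step_measurable.
have hB x : `|h x| <= B / r by exact: rescaled_step_bounded.
have b2 := in_L2_indic_ball c r5.
have hb x : \1_b x * h x = h x.
  rewrite indicE; have [xb|xb] := boolP (x \in b); first by rewrite mul1r.
  rewrite mul0r /h rescaled_step_eq0// ltNge; apply/negP => xr.
  move/negP: xb; apply; rewrite inE /b /ball/= distrC (le_lt_trans xr)//.
  by rewrite ltr_pM2r// ltr_nat.
have [ifb _] := cauchy_schwarz f2 b2.
have ib : mu.-integrable setT (EFin \o (\1_b : R -> R)).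
  have [ibb _] := cauchy_schwarz b2 b2.
  apply: eq_integrable ibb => // x _ /=.
  by rewrite indicE; case: (_ \in _); rewrite ?mulr1 ?mulr0.
(* The cutoff is there because the constant [f c] is not integrable on the line unless it is zero;
   the kernel does not see it. *)
pose w x := (f x - f c) * \1_b x.
have iw : mu.-integrable setT (EFin \o w).
  have -> : EFin \o w = (fun x => (f x * \1_b x)%:E - (f c)%:E * (\1_b x)%:E)%E.
    by apply/funext => x; rewrite -EFinM -EFinB /w /= mulrBl.
  by apply: integrableB => //; exact: integrableZl.
have ih : mu.-integrable setT (EFin \o h).
  rewrite (_ : h = (fun x => \1_b x * h x)); last by apply/funext => x; rewrite hb.
  exact: integrable_bounded_mul mh hB ib.
have iwh := integrable_bounded_mul mh hB iw.
have ifch : mu.-integrable setT (EFin \o (fun x => f c * h x)).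
  exact: integrable_scale.
have ifh : mu.-integrable setT (EFin \o (fun x => f x * h x)).
  rewrite (_ : (fun x => f x * h x) = (fun x => (f x * \1_b x) * h x)).
    exact: integrable_bounded_mul mh hB ifb.
  by apply/funext => x; rewrite -mulrA hb.
have -> : \int[mu]_x (f x * h x) - f c * H 4 = \int[mu]_x (w x * h x).
  rewrite -integral_rescaled_step -RintegralZl// -RintegralB//.
  by apply: eq_Rintegral => x _; rewrite /w -mulrA hb mulrBl.
have iaw : mu.-integrable setT (EFin \o (fun x => `|w x|)).
  exact: integrable_norm iw.
have le1 : `|\int[mu]_x (w x * h x)| <= B / r * \int[mu]_x `|w x|.
  apply: le_trans (le_normr_Rintegral _ iwh) _ => //.
  rewrite -RintegralZl//; apply: le_Rintegral => //.
  - exact: integrable_norm iwh.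
  - exact: integrable_scale.
  - by move=> x _; rewrite normrM mulrC ler_wpM2r.
move: le1; rewrite -lee_fin => /le_trans; apply.
rewrite EFinM /Rintegral fineK; last exact: integrable_fin_num.
rewrite /davg /iavg lebesgue_measure_ball//.
have -> : (\int[mu]_(y in ball c (5 * r)) `|((center (f c) \o f) y)%:E| =
    \int[mu]_x (`|w x|%R)%:E)%E.
  rewrite integral_mkcond; apply: eq_integral => x _.
  rewrite patchE /w indicE; case: (_ \in _); first by rewrite mulr1.
  by rewrite mulr0 normr0.
have r10 : 5 * r *+ 2 != 0 by rewrite mulrn_eq0/= mulf_neq0// gt_eqF.
rewrite inver (negbTE r10) muleA -EFinM lee_wpmul2r//.
  by apply: integral_ge0 => x _; rewrite lee_fin.
rewrite lee_fin le_eqVlt; apply/orP; left; apply/eqP.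
by rewrite -[5 * r *+ 2]mulr_natr; field; rewrite gt_eqF.
Qed.

End rescaled.

(* Testing the weak derivative against [bump H c r 1] bounds the averages of [f]
   at scale [r] around [c] independently of [r]; let [r] tend to [0] at a
   Lebesgue point [c]. *)
Lemma H1_bounded : exists2 K : R, 0 <= K &
  forall f g, in_L2 f -> in_L2 g -> is_weak_derivative f g ->
  {ae mu, forall x, `|f x| <= K * (L2norm f + L2norm g)}.
Proof.
have [H sH] := smooth_step R.
have [eH _ _ _ _] := sH; have L0 := step_total_gt0 sH.
have [B0 B00 HB0] := step_derive1n_bounded 0 sH.
have [B1 B10 HB1] := step_derive1n_bounded 1 sH.
pose S : R := Num.sqrt (2 * 4).
have S0 : 0 <= S by exact: sqrtr_ge0.
(* [B1] bounds the kernel at scale [1], paired with [f], and [2 * B0] bounds the bump, paired with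
   [g]; [S] comes from their supports of radius [4]. *)
pose K0 := (B1 + 2 * B0) * S.
have K00 : 0 <= K0 by rewrite mulr_ge0// addr_ge0// mulr_ge0.
exists (K0 / H 4); first by rewrite divr_ge0// ltW.
move=> f g f2 g2 wfg.
have mf := in_L2_measurable f2.
have bound c r : 0 < r -> r <= 1 ->
    `|\int[mu]_x (f x * rescaled_step H c r x)| <= K0 * (L2norm f + L2norm g).
  move=> r0 r1; have := wfg _ (bump_test_function c sH r0 r1).
  have -> : derive1 (bump H c r 1) = (fun x => rescaled_step H c r x - rescaled_step H c 1 x).
    by apply/funext => x; rewrite -derive1n1 derive1n_bump// !expr1.
  have [|||||if1 le1] := @L2_pairing_bound _ f (rescaled_step H c 1) c 4 (B1 / 1) f2.
  - exact: rescaled_step_measurable.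
  - by [].
  - by rewrite divr1.
  - by move=> x; exact: rescaled_step_bounded.
  - by move=> x cx; apply: rescaled_step_eq0 => //; rewrite mulr1.
  have [|||||ifr _] := @L2_pairing_bound _ f (rescaled_step H c r) c (4 * r) (B1 / r) f2.
  - exact: rescaled_step_measurable.
  - by rewrite mulr_ge0// ltW.
  - by rewrite divr_ge0// ltW.
  - by move=> x; exact: rescaled_step_bounded.
  - by move=> x cx; apply: rescaled_step_eq0.
  have [|||||_ leg] := @L2_pairing_bound _ g (bump H c r 1) c 4 (B0 + B0) g2.
  - exact: elementary_measurable (bump_elementary c r 1 sH).
  - by [].
  - by rewrite addr_ge0.
  - move=> x; apply: le_trans (ler_normB _ _) _.
    exact: lerD (HB0 ((x - c) / r)) (HB0 ((x - c) / 1)).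
  - by move=> x cx; apply: (bump_eq0 sH r0 r1); rewrite mulr1.
  rewrite (_ : \int[mu]_x (f x * (rescaled_step H c r x - rescaled_step H c 1 x)) =
    \int[mu]_x (f x * rescaled_step H c r x) - \int[mu]_x (f x * rescaled_step H c 1 x)).
    move=> /(canRL (subrK _)) ->; apply: le_trans (ler_normD _ _) _.
    rewrite normrN; apply: le_trans (lerD leg le1) _.
    rewrite /K0 divr1; have Nf := L2norm_ge0 f; have Ng := L2norm_ge0 g.
    have B1S : 0 <= B1 * S by rewrite mulr_ge0.
    have B0S : 0 <= B0 * S by rewrite mulr_ge0.
    have := mulr_ge0 Ng B1S; have := mulr_ge0 Nf B0S.
    rewrite -/S; lra.
  by rewrite -RintegralB//; apply: eq_Rintegral => x _; rewrite mulrBr.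
have := lebesgue_differentiation (L2_locally_integrable f2).
apply: filter_app; first exact: (ae_filter_ringOfSetsType mu).
apply: aeW => c /= lc.
rewrite mulrAC ler_pdivlMr//; apply/ler_addgt0Pr => e e0.
(* [B1 * 10] is the factor in [rescaled_step_average]; the added [1] keeps the denominator positive
   when [B1 = 0]. *)
pose d := e / (B1 * 10 + 1).
have B11 : 0 < B1 * 10 + 1 by rewrite ltr_wpDl// mulr_ge0.
have d0 : 0 < d by rewrite divr_gt0.
have : \forall r \near (0:R)^'+, (davg f c r < d%:E)%E.
  move/fine_cvgP : lc => [fin_lc].
  move=> /cvgr_lt /(_ d d0) lc.
  near=> r.
  have fr : davg f c r \is a fin_num by near: r.
  by rewrite -(fineK fr) lte_fin; near: r.
move=> [eta /= eta0 Heta].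
(* The average is over radius [5 * r], at most half of [eta]. *)
pose r := Num.min 1 (eta / 10).
have r0 : 0 < r by rewrite lt_min ltr01 divr_gt0.
have r1 : r <= 1 by rewrite ge_min lexx.
have reta : r <= eta / 10 by rewrite ge_min lexx orbT.
have {}Heta : (davg f c (5 * r) < d%:E)%E.
  apply: Heta => /=; last by rewrite mulr_gt0.
  rewrite sub0r normrN gtr0_norm ?mulr_gt0//; lra.
have le1 := rescaled_step_average c sH HB1 r0 f2.
have {}le1 : `|\int[mu]_x (f x * rescaled_step H c r x) - f c * H 4| <= e.
  rewrite -lee_fin; apply: le_trans le1 _.
  apply: le_trans (lee_wpmul2l _ (ltW Heta)) _; first by rewrite lee_fin mulr_ge0.
  rewrite -EFinM lee_fin /d mulrCA ler_piMr ?(ltW e0)// ler_pdivrMr// mul1r.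
  by rewrite lerDl.
rewrite -[X in _ * X](gtr0_norm L0) -normrM.
rewrite -[f c * H 4](subKr (\int[mu]_x (f x * rescaled_step H c r x))).
apply: le_trans (ler_normB _ _) _; apply: lerD => //.
exact: bound.
Unshelve. all: by end_near. Qed.

End H1_bounded.

(** * Growth of the pairing *)

Section decay.
Context (R : realType).
Local Notation mu := (@lebesgue_measure R).

Lemma powR_eventually_ge (e C : R) : 0 < e ->
  exists2 T0, 1 <= T0 & forall T, T0 <= T -> C <= T `^ e.
Proof.
move=> e0; exists (Num.max 1 (`|C| `^ e^-1)); first by rewrite le_max lexx.
move=> T; rewrite ge_max => /andP[T1 CT].
apply: le_trans (ler_norm C) _.
rewrite -[leLHS]powRr1// -[X in `|C| `^ X](@mulVf _ e) ?gt_eqF// powRrM.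
by apply: ge0_ler_powR => //; rewrite ?nnegrE ?powR_ge0 ?ltW// (lt_le_trans ltr01).
Qed.

Lemma OmegaE (b n t : R) :
  Omega b n t = ball (t `^ n) (t `^ b) `|` ball (- t `^ n) (t `^ b).
Proof.
have E (y x : R) : `|- y - x| = `|x + y| by rewrite -opprD normrN addrC.
by apply/seteqP; split=> x; rewrite /Omega/= /ball/= distrC E.
Qed.

(** The first entry of the minimum gives [t <= 2 * T], so the radius at most doubles. By the second,
    and since [(t / T)^n <= t / T], the centres drift by at most [T^b]. Together this makes
    [3 * T^b]. *)
Lemma Omega_subset (b n T t : R) : 0 <= b <= 1 -> 0 <= n <= 1 -> 1 <= T ->
  T <= t <= T + T `^ Num.min 1 (b + 1 - n) ->
  Omega b n t `<=` ball (T `^ n) (3 * T `^ b) `|` ball (- T `^ n) (3 * T `^ b).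
Proof.
move=> /andP[b0 b1] /andP[n0 n1] T1 /andP[Tt tT].
set a := Num.min 1 (b + 1 - n) in tT.
have T0 : 0 < T by rewrite (lt_le_trans ltr01).
have Ta : T `^ a <= T.
  by rewrite -[leRHS](powRr1 (ltW T0)) ler_powR// ge_min lexx.
have t0 : 0 < t by rewrite (lt_le_trans T0).
have tb : t `^ b <= 2 * T `^ b.
  apply: (@le_trans _ _ ((2 * T) `^ b)).
    by rewrite ge0_ler_powR ?nnegrE//; lra.
  rewrite powRM ?(ltW T0)// ler_wpM2r ?powR_ge0//.
  by apply: ler1_powR => //; rewrite ler1n.
have Ttn : T `^ n <= t `^ n by rewrite ge0_ler_powR ?nnegrE ?(ltW T0) ?(ltW t0).
have tTn : t `^ n <= T `^ n + T `^ b.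
  have s1 : 1 <= t / T by rewrite ler_pdivlMr// mul1r.
  have -> : t = T * (t / T) by rewrite mulrCA divff ?mulr1// gt_eqF.
  rewrite powRM ?(ltW T0)// ?(le_trans _ s1)//.
  have le1 : (t / T) `^ n <= 1 + T `^ (a - 1).
    apply: le_trans (ler1_powR s1 n1) _.
    rewrite ler_pdivrMr// mulrDl mul1r -[X in _ * X](powRr1 (ltW T0)) -powRD ?subrK//.
    by apply/implyP => _; rewrite gt_eqF.
  apply: le_trans (ler_wpM2l (powR_ge0 _ _) le1) _.
  rewrite mulrDr mulr1 lerD2l -powRD; last by apply/implyP => _; rewrite gt_eqF.
  apply: ler_powR => //.
  have : a <= b + 1 - n by rewrite ge_min lexx orbT.
  lra.
have : 0 <= T `^ b by exact: powR_ge0.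
rewrite OmegaE => Tb x [|] /=; rewrite /ball/= => H; [left|right].
  move: H; rewrite !ltr_distl => /andP[? ?]; apply/andP; split; lra.
move: H; rewrite !ltr_distl => /andP[? ?]; apply/andP; split; lra.
Qed.

(** Almost everywhere [f^4 <= K^2 * f^2]. *)
Lemma quartic_bound (f : R -> R) (K : R) : in_L2 f -> 0 <= K ->
  {ae mu, forall x, `|f x| <= K} ->
  mu.-integrable setT (EFin \o (fun x => f x ^+ 4)) /\
  \int[mu]_x (f x ^+ 4) <= K ^+ 2 * L2norm f ^+ 2.
Proof.
move=> f2 K0 fK; have mf := in_L2_measurable f2.
have if2 := Lfun2_integrable_sqr f2.
have iK := integrable_scale (K ^+ 2) if2.
have m4 : measurable_fun setT (EFin \o (fun x => f x ^+ 4)).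
  by apply/measurable_EFinP; exact: measurable_funX.
have f40 x : 0 <= f x ^+ 4 by rewrite -[4%N]/(2 * 2)%N exprM sqr_ge0.
have le4 : (\int[mu]_x (f x ^+ 4)%:E <= \int[mu]_x (K ^+ 2 * f x ^+ 2)%:E)%E.
  apply: ae_ge0_le_integral => //.
  - by move=> x _; rewrite lee_fin.
  - by move=> x _; rewrite lee_fin mulr_ge0 ?sqr_ge0.
  - by case/integrableP: iK.
  - move: fK; apply: filter_app; first exact: (ae_filter_ringOfSetsType mu).
    apply: aeW => x /= fxK _; rewrite lee_fin -[4%N]/(2 + 2)%N exprD.
    rewrite ler_wpM2r ?sqr_ge0// -(real_normK (num_real (f x))).
    by rewrite lerXn2r// nnegrE.
have iKfin : (\int[mu]_x (K ^+ 2 * f x ^+ 2)%:E)%E \is a fin_num.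
  exact: integrable_fin_num.
have i4 : mu.-integrable setT (EFin \o (fun x => f x ^+ 4)).
  apply/integrableP; split=> //.
  under eq_integral => x _ do rewrite /= ger0_norm//.
  apply: le_lt_trans le4 _; rewrite ltey_eq; apply/orP; left; exact: iKfin.
split=> //; rewrite L2norm_sqr// -RintegralZl//.
by rewrite /Rintegral fine_le//; exact: integrable_fin_num.
Qed.

(** The narrow part of the derivative of the bump is nonnegative, and at least [1 / r] on the ball
    because [H] has slope at least [1] on [[-3, 3]]; the wide part subtracts at most [B / s]. *)
Lemma bump_weight_ge (H U : R -> R) (c r s B : R) : step_function H ->
  (forall x, `|derive1 H x| <= B) -> 0 < r -> r <= s ->
  (forall x, 0 <= U x) -> mu.-integrable setT (EFin \o U) ->
  mu.-integrable setT (EFin \o (fun x => U x * derive1 (bump H c r s) x)) ->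
  r^-1 * (\int[mu]_(x in ball c (3 * r)) U x) - B / s * (\int[mu]_x U x)
  <= \int[mu]_x (U x * derive1 (bump H c r s) x).
Proof.
move=> sH HB r0 rs U0 iU iUg; have s0 := lt_le_trans r0 rs.
have mb : measurable (ball c (3 * r) : set R) by exact: measurable_ball.
have ib : mu.-integrable setT (EFin \o (U \_ (ball c (3 * r)))).
  rewrite (_ : U \_ _ = (fun x => U x * \1_(ball c (3 * r)) x)).
    apply: (@integrable_bounded_mul _ U _ 1) => //.
    by move=> x; rewrite indicE; case: (_ \in _); rewrite ?normr1 ?normr0.
  by apply/funext => x; rewrite patchE indicE; case: (_ \in _); rewrite ?mulr1 ?mulr0.
have ibr := integrable_scale r^-1 ib; have iUs := integrable_scale (B / s) iU.
rewrite Rintegral_mkcond -RintegralZl// -RintegralZl// -RintegralB//.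
apply: le_Rintegral => //.
  have -> : EFin \o (fun x => r^-1 * (U \_ (ball c (3 * r))) x - B / s * U x) =
     (fun x => (r^-1 * (U \_ (ball c (3 * r))) x)%:E - (B / s * U x)%:E)%E by [].
  exact: integrableB.
move=> x _; rewrite -derive1n1 derive1n_bump// !expr1 mulrBr.
have Hs : derive1 H ((x - c) / s) / s <= B / s.
  by rewrite ler_pM2r ?invr_gt0// (le_trans (ler_norm _)).
apply: lerB; last by rewrite mulrC ler_wpM2r.
have [_ _ _ H0 H1] := sH.
rewrite patchE; case: ifPn => xb; last first.
  by rewrite mulr0 mulr_ge0// divr_ge0 ?H0 ?(ltW r0).
rewrite mulrC ler_wpM2l// ler_peMl ?invr_ge0 ?(ltW r0)//.
apply: H1; move: xb; rewrite inE /ball/= distrC => xb.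
by rewrite -ler_norml normrM normfV (gtr0_norm r0) ler_pdivrMr// ltW.
Qed.

(** The indicator of [D] is at most the sum of the other two. Overlaps, which occur for the two
    balls when [n] is small, only increase the right-hand side. *)
Lemma le_integral_cover (U : R -> R) (D A B : set R) :
  measurable D -> measurable A -> measurable B -> D `<=` A `|` B ->
  (forall x, 0 <= U x) -> mu.-integrable setT (EFin \o U) ->
  (\int[mu]_(x in D) (U x)%:E <=
   (\int[mu]_(x in A) U x + \int[mu]_(x in B) U x)%:E)%E.
Proof.
move=> mD mA mB DAB U0 iU.
have i1 (E : set R) : measurable E ->
    mu.-integrable setT (EFin \o (fun x => U x * \1_E x)).
  move=> mE; apply: (@integrable_bounded_mul _ U _ 1) => //.
  by move=> x; rewrite indicE; case: (_ \in _); rewrite ?normr1 ?normr0.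
have E1 (E : set R) :
    (\int[mu]_(x in E) (U x)%:E = \int[mu]_x (U x * \1_E x)%:E)%E.
  rewrite integral_mkcond; apply: eq_integral => x _; rewrite patchE indicE.
  by case: (_ \in _); rewrite ?mulr1 ?mulr0.
have fin (E : set R) : measurable E ->
    (\int[mu]_(x in E) (U x)%:E)%E \is a fin_num.
  by move=> mE; rewrite E1; exact: integrable_fin_num (i1 E mE).
rewrite -(fineK (fin _ mD)) lee_fin {1 2}/Rintegral !E1.
rewrite -[fine (\int[mu]_x (U x * \1_D x)%:E)]/(\int[mu]_x (U x * \1_D x)).
rewrite -[fine (\int[mu]_x (U x * \1_A x)%:E)]/(\int[mu]_x (U x * \1_A x)).
rewrite -[fine (\int[mu]_x (U x * \1_B x)%:E)]/(\int[mu]_x (U x * \1_B x)).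
rewrite -RintegralD//; [|exact: i1|exact: i1].
have iAB : mu.-integrable setT (EFin \o (fun x => U x * \1_A x + U x * \1_B x)).
  have -> : EFin \o (fun x => U x * \1_A x + U x * \1_B x) =
    (fun x => (U x * \1_A x)%:E + (U x * \1_B x)%:E)%E by [].
  by apply: integrableD => //; exact: i1.
apply: le_Rintegral => //; first exact: i1.
move=> x _; rewrite -mulrDr ler_wpM2l// !indicE.
have [xD|xD] := boolP (x \in D); last by rewrite addr_ge0.
have [xA|xB] := DAB x (set_mem xD).
  by rewrite (mem_set xA) lerDl.
by rewrite (mem_set xB) lerDr.
Qed.

(** As [r <= s], the narrow step dominates every derivative, at most [B / r^k] for each part, while
    the wide one determines the support, of radius [4 * s]. *)
Lemma bump_pairing_bound (H : R -> R) (B : R) k (f : R -> R) (c r s : R) :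
  step_function H -> 0 <= B -> (forall x, `|derive1n k H x| <= B) ->
  0 < r -> r <= s -> in_L2 f ->
  `|\int[mu]_x (f x * derive1n k (bump H c r s) x)|
  <= L2norm f * ((2 * B / r ^+ k) * Num.sqrt (2 * (4 * s))).
Proof.
move=> sH B0 HB r0 rs f2; have s0 := lt_le_trans r0 rs.
have rk : 0 < r ^+ k by rewrite exprn_gt0.
have sk : 0 < s ^+ k by rewrite exprn_gt0.
have [|||||_ //] := @L2_pairing_bound _ f (derive1n k (bump H c r s)) c (4 * s)
  (2 * B / r ^+ k) f2.
- exact: elementary_measurable (elementary_derive1n k (bump_elementary c r s sH)).
- by rewrite mulr_ge0// ltW.
- by rewrite divr_ge0 ?mulr_ge0// ltW.
- move=> x; rewrite derive1n_bump//; apply: le_trans (ler_normB _ _) _.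
  rewrite !normrM !normfV (gtr0_norm rk) (gtr0_norm sk).
  have -> : 2 * B / r ^+ k = B / r ^+ k + B / r ^+ k by ring.
  apply: lerD; first by rewrite ler_pM2r ?invr_gt0.
  apply: ler_pM => //; first by rewrite invr_ge0 ltW.
  by rewrite lef_pV2 ?posrE// lerXn2r// ?nnegrE ltW.
- by move=> x; exact: derive1n_bump_eq0.
Qed.

Section pairing.
Variables (p : nat) (b n M0 C : R) (u : R -> R -> R).
Hypotheses (b0 : 0 < b) (b1 : b < 2 / 3) (n0 : 0 <= n) (n1 : n < 1 - b / 2).
Hypotheses (eqn : solves_gKdV p u) (u2 : forall t, in_L2 (u t)).
Hypothesis uM : forall t, L2norm (u t) <= M0.
Hypothesis U0 : forall t x, 0 <= u t x ^+ p.
Hypothesis iU : forall t, mu.-integrable setT (EFin \o (fun x => u t x ^+ p)).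
Hypothesis UC : forall t, \int[mu]_x (u t x ^+ p) <= C.

(** The equation moves all derivatives onto the bump: the nonlinear term gives the gain on the ball
    and the loss [B1 / s * C], the dispersive term the loss with [r^3]. *)
Lemma bump_pairing_rate (H : R -> R) (B1 B3 c r s t : R) : step_function H ->
  0 <= B3 -> (forall x, `|derive1 H x| <= B1) ->
  (forall x, `|derive1n 3 H x| <= B3) -> 0 < r -> r <= s ->
  exists2 D, is_derive t 1 (fun t => \int[mu]_x (u t x * bump H c r s x)) D &
    r^-1 * (\int[mu]_(x in ball c (3 * r)) (u t x ^+ p)) - B1 / s * C
     - M0 * ((2 * B3 / r ^+ 3) * Num.sqrt (2 * (4 * s))) <= D.
Proof.
move=> sH B30 HB1 HB3 r0 rs; have s0 := lt_le_trans r0 rs.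
eexists; first exact: (eqn (bump_test_function c sH r0 rs) t).
have B10 : 0 <= B1 by apply: le_trans (HB1 0).
rewrite addrC lerD//.
  rewrite lerNl; apply: le_trans (ler_norm _) _; rewrite normrN.
  apply: le_trans (bump_pairing_bound c sH B30 HB3 r0 rs (u2 t)) _.
  have r3 : 0 <= (r ^+ 3)^-1 by rewrite invr_ge0 exprn_ge0// ltW.
  by rewrite ler_wpM2r// !mulr_ge0.
have iUg : mu.-integrable setT
    (EFin \o (fun x => u t x ^+ p * derive1 (bump H c r s) x)).
  apply: (@integrable_bounded_mul _ _ _ (B1 / r + B1 / s)) => //.
    exact: elementary_measurable (elementary_derive1n 1 (bump_elementary c r s sH)).
  move=> x; rewrite -derive1n1 derive1n_bump// !expr1.
  apply: le_trans (ler_normB _ _) _; rewrite !normrM !normfV.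
  rewrite (gtr0_norm r0) (gtr0_norm s0).
  by apply: lerD; rewrite ler_pM2r ?invr_gt0//; exact: HB1.
apply: le_trans (bump_weight_ge sH HB1 r0 rs (U0 t) (iU t) iUg).
by rewrite lerB// ler_wpM2l// divr_ge0// ltW.
Qed.

Lemma Omega_integral_small (M c0 : R) : 0 < c0 -> exists2 t, M < t &
  (\int[mu]_(x in Omega b n t) (u t x ^+ p)%:E < c0%:E)%E.
Proof.
(* To be used with [x] the total gain [c0 / r], [y] and [z] the gains on the two balls, [d] the
   dispersive loss and [e] the loss from the wide part, each incurred at both centres. *)
have lin (x y z d e f : R) : x <= y + z -> 2 * d <= f -> 2 * e <= f ->
    x - f - f <= (y - e - d) + (z - e - d) by lra.
have n1' : n <= 1 by have := n1; have := b0; lra.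
have b1' : b <= 1 by have := b1; lra.
move=> c00; apply: contrapT => /forall2NP Hc.
have {}Hc t : M < t -> (c0%:E <= \int[mu]_(x in Omega b n t) (u t x ^+ p)%:E)%E.
  by move=> Mt; have [//|/negP] := Hc t; rewrite -leNgt.
have M00 : 0 <= M0 by apply: le_trans (uM 0); exact: L2norm_ge0.
have C0 : 0 <= C by apply: le_trans (UC 0); apply: Rintegral_ge0 => x _; exact: U0.
have [H sH] := smooth_step R.
have [B0 B00 HB0] := step_derive1n_bounded 0 sH.
have [B1 B10 HB1] := step_derive1n_bounded 1 sH.
have [B3 B30 HB3] := step_derive1n_bounded 3 sH.
(* [tau / T^b = T^m] measures the growth of the pairing over a time [tau]; it has
   to beat the a priori bound [O(T^(q/2))], whence the constraint [q < 2 m]. *)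
pose m := Num.min (1 - b) (1 - n).
have bm : b / 2 < m by rewrite lt_min; apply/andP; split; have := (b1, n1); case; lra.
have [q [bq q4 qm]] : exists q, [/\ b < q, q < 4 * b & q < 2 * m].
  exists ((b + Num.min (4 * b) (2 * m)) / 2).
  have h : b < Num.min (4 * b) (2 * m) by rewrite lt_min; apply/andP; split; have := b0; lra.
  have h1 : Num.min (4 * b) (2 * m) <= 4 * b by rewrite ge_min lexx.
  have h2 : Num.min (4 * b) (2 * m) <= 2 * m by rewrite ge_min lexx orbT.
  by split; lra.
pose S : R := Num.sqrt 8.
have S0 : 0 <= S by exact: sqrtr_ge0.
(* Over both centres the dispersive loss is [A1 * E / r^3] and the wide loss [A2 / s], with [E] the
   square root of [s]; the pairing is at most [A3 / 2 * E] at any time. *)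
pose A1 := 4 * M0 * B3 * S; pose A2 := 2 * B1 * C; pose A3 := 8 * M0 * B0 * S.
have [T1 T11 HT1] : exists2 T1, 1 <= T1 & forall T, T1 <= T -> 4 * A1 / c0 <= T `^ (2 * b - q / 2).
  by apply: powR_eventually_ge; lra.
have [T2 _ HT2] : exists2 T1, 1 <= T1 & forall T, T1 <= T -> 4 * A2 / c0 <= T `^ (q - b).
  by apply: powR_eventually_ge; lra.
(* The added [1] makes [c3] below strict, as the final contradiction requires. *)
have [T3 _ HT3] : exists2 T1, 1 <= T1 & forall T, T1 <= T -> (2 * A3 + 1) / c0 <= T `^ (m - q / 2).
  by apply: powR_eventually_ge; lra.
pose T := Num.max (Num.max T1 T2) (Num.max T3 (M + 1)).
have {}HT1 : 4 * A1 / c0 <= T `^ (2 * b - q / 2) by apply: HT1; rewrite !le_max lexx.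
have {}HT2 : 4 * A2 / c0 <= T `^ (q - b) by apply: HT2; rewrite !le_max lexx !orbT.
have {}HT3 : (2 * A3 + 1) / c0 <= T `^ (m - q / 2) by apply: HT3; rewrite !le_max lexx !orbT.
have T1' : 1 <= T by rewrite !le_max T11.
have MT : M < T by rewrite !lt_max ltrDl ltr01 !orbT.
have T0 : 0 < T by rewrite (lt_le_trans ltr01).
have powTD x y : T `^ (x + y) = T `^ x * T `^ y.
  by rewrite powRD//; apply/implyP => _; rewrite gt_eqF.
pose r := T `^ b; pose s := T `^ q; pose E := T `^ (q / 2).
pose tau := T `^ Num.min 1 (b + 1 - n).
have r0 : 0 < r by exact: powR_gt0.
have s0 : 0 < s by exact: powR_gt0.
have E0 : 0 < E by exact: powR_gt0.
have tau0 : 0 < tau by exact: powR_gt0.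
have rs : r <= s by apply: ler_powR => //; exact: ltW.
have sE : Num.sqrt (2 * (4 * s)) = S * E.
  rewrite (_ : 2 * (4 * s) = 8 * E ^+ 2); last first.
    by rewrite /s (_ : q = q / 2 + q / 2) ?powTD -/E; [ring|field].
  by rewrite sqrtrM// sqrtr_sqr gtr0_norm.
have r2E : r ^+ 2 = T `^ (2 * b - q / 2) * E by rewrite -powTD subrK mulr_natl mulr2n powTD.
have sr : s = T `^ (q - b) * r by rewrite -powTD subrK.
(* The exponent of [tau] is [m + b]. *)
have tauE : tau = T `^ (m - q / 2) * E * r.
  rewrite -!powTD subrK /tau; congr (_ `^ _); rewrite /m addr_minl; congr Num.min; ring.
(* By [c1] and [c2] each type of loss is at most a quarter of the gain [c0 / r], leaving half of it;
   by [c3] the growth over time [tau] exceeds what the bounds at the two end times allow. *)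
have c1 : A1 * E <= c0 / 4 * r ^+ 2.
  rewrite r2E mulrA ler_pM2r//; move: HT1; rewrite ler_pdivrMr//; lra.
have c2 : A2 * r <= c0 / 4 * s.
  rewrite sr mulrA ler_pM2r//; move: HT2; rewrite ler_pdivrMr//; lra.
have c3 : A3 * E < c0 / 2 * (tau / r).
  rewrite tauE mulfK ?gt_eqF// mulrA ltr_pM2r//.
  move: HT3; rewrite ler_pdivrMr//; lra.
pose I t := \int[mu]_x (u t x * bump H (T `^ n) r s x)
  + \int[mu]_x (u t x * bump H (- T `^ n) r s x).
have rate t : T <= t <= T + tau -> exists2 D, is_derive t 1 I D & c0 / 2 / r <= D.
  move=> tT.
  have [D1 dD1 leD1] := bump_pairing_rate (T `^ n) t sH B30 HB1 HB3 r0 rs.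
  have [D2 dD2 leD2] := bump_pairing_rate (- T `^ n) t sH B30 HB1 HB3 r0 rs.
  exists (D1 + D2); first exact: is_deriveD dD1 dD2.
  have tM : M < t by case/andP: tT => Tt _; exact: lt_le_trans Tt.
  have J : c0 <= \int[mu]_(x in ball (T `^ n) (3 * r)) (u t x ^+ p)
      + \int[mu]_(x in ball (- T `^ n) (3 * r)) (u t x ^+ p).
    rewrite -lee_fin; apply: le_trans (Hc t tM) _.
    apply: le_integral_cover => //; [|exact: measurable_ball..|].
      by rewrite OmegaE; apply: measurableU; exact: measurable_ball.
    by apply: (Omega_subset _ _ T1' tT); rewrite ?n0// ltW.
  have J' := ler_wpM2l (ltW (_ : 0 < r^-1)) J.
  have {}J' : c0 / r <= r^-1 * (\int[mu]_(x in ball (T `^ n) (3 * r)) (u t x ^+ p))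
      + r^-1 * (\int[mu]_(x in ball (- T `^ n) (3 * r)) (u t x ^+ p)).
    by rewrite -mulrDr mulrC J'// invr_gt0.
  rewrite sE in leD1 leD2.
  apply: le_trans (lerD leD1 leD2).
  have e1 : 2 * (M0 * (2 * B3 / r ^+ 3 * (S * E))) <= c0 / 4 / r.
    have -> : 2 * (M0 * (2 * B3 / r ^+ 3 * (S * E))) = A1 * E / r ^+ 2 / r.
      by rewrite /A1; field; rewrite gt_eqF.
    by rewrite ler_pM2r ?invr_gt0// ler_pdivrMr// exprn_gt0.
  have e2 : 2 * (B1 / s * C) <= c0 / 4 / r.
    have -> : 2 * (B1 / s * C) = A2 / s by rewrite /A2; ring.
    by rewrite ler_pdivlMr// mulrAC ler_pdivrMr.
  have -> : c0 / 2 / r = c0 / r - c0 / 4 / r - c0 / 4 / r.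
    by field; rewrite gt_eqF.
  exact: lin J' e1 e2.
(* The mean value theorem takes the derivative as a function, so the rates are chosen
   simultaneously, with the junk value [0] outside the time interval. *)
have [D HD] : {D : R -> R | forall t, T <= t <= T + tau ->
    is_derive t 1 I (D t) /\ c0 / 2 / r <= D t}.
  have := @choice R R (fun t d => T <= t <= T + tau -> is_derive t 1 I d /\ c0 / 2 / r <= d).
  case=> [t|D HD]; last by apply: cid; exists D.
  have [tT|tT] := pselect (T <= t <= T + tau); last by exists 0.
  by have [d] := rate t tT; exists d.
have TT : T < T + tau by rewrite ltrDl.
have [||xi] := @MVT _ I D T (T + tau) TT.
- by move=> t; rewrite in_itv/= => /andP[? ?]; apply: (HD t _).1; rewrite !ltW.
- apply: derivable_within_continuous => t; rewrite in_itv/= => tT.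
  by have [[]] := HD t tT.
rewrite in_itv/= => /andP[Txi xiT] IE.
have [_ Dxi] : is_derive xi 1 I (D xi) /\ c0 / 2 / r <= D xi by apply: HD; rewrite !ltW.
have Ib t : `|I t| <= A3 / 2 * E.
  have P c : `|\int[mu]_x (u t x * bump H c r s x)| <= A3 / 4 * E.
    apply: le_trans (bump_pairing_bound c sH B00 HB0 r0 rs (u2 t)) _.
    rewrite expr0 divr1 sE.
    apply: (@le_trans _ _ (M0 * (2 * B0 * (S * E)))).
      by rewrite ler_wpM2r// !mulr_ge0// ltW.
    by rewrite le_eqVlt; apply/orP; left; apply/eqP; rewrite /A3; field.
  apply: le_trans (ler_normD _ _) _; apply: le_trans (lerD (P _) (P _)) _.
  by rewrite le_eqVlt; apply/orP; left; apply/eqP; field.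
have : c0 / 2 * (tau / r) <= A3 * E.
  apply: (@le_trans _ _ (I (T + tau) - I T)).
    rewrite IE [X in D _ * X]addrAC subrr add0r.
    by rewrite mulrCA mulrC ler_pM2r.
  apply: le_trans (ler_norm _) _; apply: le_trans (ler_normB _ _) _.
  apply: le_trans (lerD (Ib _) (Ib _)) _.
  by rewrite le_eqVlt; apply/orP; left; apply/eqP; field.
by rewrite leNgt c3.
Qed.

End pairing.

End decay.

(** * Uniform bounds on the integral of [u^p], and the lower limit *)

Theorem theorem1p9 (R : realType) (p : nat) (b n : R)
    (u0 : R -> R) (u : R -> R -> R)
    (hp : p = 2%N \/ p = 4%N)
    (hb : 0 < b < p%:R / (2 * p%:R - 1))
    (hn : 0 <= n < 1 - b / 2)
    (hu0_L2 : p = 2%N -> in_L2 u0)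
    (hu0_H1 : p = 4%N -> in_H1 u0)
    (hu : gKdV_global_solution p u0 u) :
  limf_einf
    (fun t : R => (\int[@lebesgue_measure R]_(x in Omega b n t) (u t x ^+ p)%:E)%E)
    (pinfty_nbhs R) = 0%:E.
Proof.
have [eqn _ mass hL2 hH1] := hu.
have u2 t : in_L2 (u t).
  by case: hp => hp; [have [+ _] := hL2 hp; exact|have [[/(_ t)[]]] := hH1 hp].
have uM t : L2norm (u t) <= L2norm u0 by rewrite mass.
have U0 t x : 0 <= u t x ^+ p.
  by case: hp => ->; rewrite ?sqr_ge0// -[4%N]/(2 * 2)%N exprM sqr_ge0.
(* The bound on [b] is [2/3] for [p = 2] and [4/7] for [p = 4]. *)
have b23 : b < 2 / 3.
  case/andP: hb => _ /lt_le_trans; apply.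
  by case: hp => ->; rewrite ler_pdivrMr; lra.
have [C UC] : exists C, forall t,
    (@lebesgue_measure R).-integrable setT (EFin \o (fun x => u t x ^+ p)) /\
    \int[@lebesgue_measure R]_x (u t x ^+ p) <= C.
  case: hp => hp.
    exists (L2norm u0 ^+ 2) => t; rewrite hp; split.
      exact: Lfun2_integrable_sqr (u2 t).
    by rewrite -L2norm_sqr// mass.
  have [[uH1 _] [M HM]] := hH1 hp.
  have [K K0 HK] := H1_bounded R.
  (* One [M] bounds the L^2 norm of [u t], the other that of its weak derivative. *)
  exists ((K * (M + M)) ^+ 2 * L2norm u0 ^+ 2) => t; rewrite hp.
  have [_ dne] := uH1 t.
  (* Membership in H^1 makes the set nonempty, so the choice does not fall back on its default
     [cst 0]. *)
  have [d2 wd] : L2_weak_derivatives (u t) (weak_derivative (u t)).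
    by have [g gd] := dne; apply: xgetPex; exists g.
  have H1M := HM t.
  have H1ge x y : 0 <= x -> 0 <= y -> x <= Num.sqrt (x ^+ 2 + y ^+ 2).
    move=> x0 y0; rewrite -[leLHS](ger0_norm x0) -sqrtr_sqr ler_wsqrtr//.
    by rewrite lerDl sqr_ge0.
  have le1 : L2norm (u t) <= M.
    by apply: le_trans H1M; apply: H1ge; exact: L2norm_ge0.
  have le2 : L2norm (weak_derivative (u t)) <= M.
    by apply: le_trans H1M; rewrite /H1norm addrC; apply: H1ge; exact: L2norm_ge0.
  have M0 : 0 <= M := le_trans (L2norm_ge0 _) le1.
  rewrite -(mass t); apply: quartic_bound => //.
    by rewrite mulr_ge0// addr_ge0.
  have := HK _ _ (u2 t) d2 wd.
  apply: filter_app; first exact: (ae_filter_ringOfSetsType (@lebesgue_measure R)).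
  apply: aeW => x /= /le_trans; apply.
  by rewrite ler_wpM2l// lerD.
case/andP: hb => b0 _; case/andP: hn => n0 n1.
have small := Omega_integral_small b0 b23 n0 n1 eqn u2 uM U0
  (fun t => (UC t).1) (fun t => (UC t).2).
(* The lower limit is a supremum of infima over neighbourhoods of infinity. Each contains a
   half-line, on which [small] finds values below any [e > 0]; conversely the integrand is
   nonnegative, so the neighbourhood [setT] gives the lower bound. *)
rewrite limf_einfE; apply/eqP; rewrite eq_le; apply/andP; split.
  apply: ge_ereal_sup => _ [V [M [_ MV]] <-].
  apply/lee_addgt0Pr => e e0; rewrite add0e.
  have [t Mt lt] := small M e e0.
  apply: le_trans (ltW lt); apply: ereal_inf_lbound.
  by exists t => //; exact: MV.
apply: le_ereal_sup_tmp; eexists.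
  by exists setT; [exact: filterT|reflexivity].
by apply: le_ereal_inf_tmp => _ [t _ <-]; apply: integral_ge0 => x _; rewrite lee_fin.
Qed.
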